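(* If $M$ and $M'$ are noncrossing matchings on $\langle 0,2n-1\rangle$, then $$d_{ncm}(M,M')=d_{mat}(M,M')=n-\pi_0(M,M').$$
   Context: $\langle 0,2n-1\rangle=\{0,1,\ldots,2n-1\}$, $n\ge1$. A matching on this set is a partition of it into $n$ subsets of size $2$ (pairs); it is noncrossing if there are no $i<j<k<\ell$ with $\{i,k\}$ and $\{j,\ell\}$ both pairs. $M'$ is a flip of $M$ if $M'$ is obtained from $M$ by replacing two pairs $\{i,j\},\{k,\ell\}$ of $M$ by $\{i,\ell\},\{j,k\}$. $G_{mat}$ is the graph whose vertices are all matchings on $\langle 0,2n-1\rangle$ and whose edges are the pairs $(M,M')$ such that $M'$ is a flip of $M$; $G_{ncm}$ is the graph whose vertices are the noncrossing matchings on $\langle 0,2n-1\rangle$, with edges again the pairs related by a flip. $d_{mat}$ and $d_{ncm}$ are the graph distance functions on $G_{mat}$ and $G_{ncm}$. For matchings $M,M'$, $\pi_0(M,M')$ is the number of equivalence classes of the equivalence relation on $\langle 0,2n-1\rangle$ generated by $i\sim j$ for every $\{i,j\}\in M$ and for every $\{i,j\}\in M'$. *)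

(* Defs.v *)
From mathcomp Require Import all_boot.

Set Implicit Arguments.
Unset Strict Implicit.
Unset Printing Implicit Defensive.

Section GraphDistance.
Variables (V : finType) (e : rel V).
Implicit Types x y : V.

Definition walk x y (k : nat) : bool :=
  [exists p : k.-tuple V, path e x p && (y == last x p)].

Lemma walkP x y k :
  reflect (exists p, [/\ size p = k, path e x p & y = last x p]) (walk x y k).
Proof.
apply: (iffP existsP) => [[p /andP[xp /eqP yp]]|[p [sp xp yp]]].
  by exists p; rewrite size_tuple.
have sz : size p == k by apply/eqP.
by exists (Tuple sz); rewrite /= xp yp eqxx.
Qed.

Lemma connect_walk x y : connect e x y -> exists k, walk x y k.
Proof. by case/connectP=> p xp yp; exists (size p); apply/walkP; exists p. Qed.

(* [None] stands for an infinite distance (no path from x to y). *)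
Definition dist x y : option nat :=
  match @idP (connect e x y) with
  | ReflectT xy => Some (ex_minn (connect_walk xy))
  | ReflectF _ => None
  end.

Lemma dist_SomeP x y k :
  dist x y = Some k <-> walk x y k /\ (forall m, walk x y m -> k <= m).
Proof.
rewrite /dist; case: {-}_ / idP => [xy|nxy].
  case: ex_minnP => d xd dmin; split=> [[<-] //|[xk kmin]].
  by congr Some; apply/eqP; rewrite eqn_leq dmin //= kmin.
split=> // -[/walkP[p [_ xp yp]] _].
by case: nxy; apply/connectP; exists p.
Qed.

Lemma dist_NoneP x y : dist x y = None <-> ~ connect e x y.
Proof. by rewrite /dist; case: {-}_ / idP. Qed.

End GraphDistance.

Section Matchings.
Variable n : nat.
Implicit Types (S : {set {set 'I_(2 * n)}}).

Definition is_matching S : bool :=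
  partition S [set: 'I_(2 * n)] && [forall B in S, #|B| == 2].

Definition noncrossing S : bool :=
  [forall i : 'I_(2 * n), forall j : 'I_(2 * n),
   forall k : 'I_(2 * n), forall l : 'I_(2 * n),
     [&& i < j, j < k & k < l] ==>
       ~~ (([set i; k] \in S) && ([set j; l] \in S))].

Definition matching := {S | is_matching S}.
Definition ncmatching := {M : matching | noncrossing (val M)}.

Coercion matching_of_ncm (N : ncmatching) : matching := val N.

Definition flip : rel matching := fun M M' =>
  [exists i : 'I_(2 * n), exists j : 'I_(2 * n),
   exists k : 'I_(2 * n), exists l : 'I_(2 * n),
     [&& [set i; j] \in val M, [set k; l] \in val M,
         [set i; j] != [set k; l] &
         val M' == (val M :\: [set [set i; j]; [set k; l]])
                   :|: [set [set i; l]; [set j; k]]]].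

Definition d_mat (M M' : matching) : option nat := dist flip M M'.

Definition d_ncm (M M' : ncmatching) : option nat :=
  dist (fun N N' : ncmatching => flip N N') M M'.

Definition adj (M M' : matching) : rel 'I_(2 * n) :=
  fun i j => ([set i; j] \in val M) || ([set i; j] \in val M').

(* [adj M M'] is symmetric, so its reflexive transitive closure is the
   equivalence relation it generates. *)
Definition pi0 (M M' : matching) : nat :=
  #|equivalence_partition (connect (adj M M')) [set: 'I_(2 * n)]|.

Lemma adj_sym (M M' : matching) : symmetric (adj M M').
Proof. by move=> i j; rewrite /adj (setUC [set i]). Qed.

Lemma adj_equiv (M M' : matching) : equivalence_rel (connect (adj M M')).
Proof.
apply/equivalence_relP; split=> [x|x y]; first exact: connect0.
exact/same_connect/sym_connect_sym/adj_sym.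
Qed.

Lemma matching_partition (M : matching) : partition (val M) [set: 'I_(2 * n)].
Proof. by case/andP: (valP M). Qed.

Lemma matching_block_eq (M : matching) A B i :
  A \in val M -> B \in val M -> i \in A -> i \in B -> A = B.
Proof.
have tM := partition_trivIset (matching_partition M).
by move=> MA MB iA iB; rewrite -(def_pblock tM MA iA) (def_pblock tM MB iB).
Qed.

Lemma matching_mate (M : matching) i :
  exists2 j, j != i & [set i; j] \in val M.
Proof.
have iM : i \in cover (val M).
  by rewrite (cover_partition (matching_partition M)) inE.
have BM := pblock_mem iM.
have iB : i \in pblock (val M) i by rewrite mem_pblock.
have /andP[_ /forall_inP/(_ _ BM)/cards2P[x [y [nxy eB]]]] := valP M.
move: iB; rewrite eB !inE => /orP[]/eqP ei.
  by exists y; [rewrite ei eq_sym|rewrite ei -eB].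
by exists x; [rewrite ei|rewrite ei setUC -eB].
Qed.

Lemma flip_sym : symmetric flip.
Proof.
suff F : forall M M', flip M M' -> flip M' M.
  by move=> M M'; apply/idP/idP; apply: F.
move=> M M' /existsP[i /existsP[j /existsP[k /existsP[l]]]].
case/and4P=> [MA MB nAB /eqP eM'].
have eqM := matching_block_eq (M := M).
have djt x : x \in [set i; j] -> x \in [set k; l] -> False.
  by move=> xA xB; case/eqP: nAB; exact: eqM xA xB.
have iA : i \in [set i; j] by rewrite set21.
have jA : j \in [set i; j] by rewrite set22.
have kB : k \in [set k; l] by rewrite set21.
have lB : l \in [set k; l] by rewrite set22.
have nC : [set i; l] \notin val M.
  apply/negP=> MC; apply: (djt l) => //.
  by rewrite (eqM _ _ i MA MC) ?set21 ?set22.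
have nD : [set j; k] \notin val M.
  apply/negP=> MD; apply: (djt k) => //.
  by rewrite (eqM _ _ j MA MD) ?set21 ?set22.
apply/existsP; exists i; apply/existsP; exists l.
apply/existsP; exists k; apply/existsP; exists j.
rewrite (setUC [set k] [set j]) (setUC [set l] [set k]) eM'.
rewrite !inE !eqxx /= !orbT /=.
apply/andP; split.
  apply/negP=> /eqP eCD; have := set21 i l; rewrite eCD !inE => /orP[]/eqP ei.
    have /andP[_ /forall_inP/(_ _ MA)] := valP M.
    by rewrite ei setUid cards1.
  by apply: (djt i) => //; rewrite ei.
apply/eqP/setP=> X; rewrite !inE.
case: (eqVneq X [set i; j]) => [->|_]; first by rewrite MA orbT.
case: (eqVneq X [set k; l]) => [->|_]; first by rewrite MB !orbT.
case: (eqVneq X [set i; l]) => [->|_]; first by rewrite (negPf nC).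
case: (eqVneq X [set j; k]) => [->|_]; first by rewrite (negPf nD).
by rewrite /= !orbF.
Qed.

Lemma pi0_le (M M' : matching) : pi0 M M' <= n.
Proof.
have eqR : {in [set: 'I_(2 * n)] & &, equivalence_rel (connect (adj M M'))}.
  by move=> x y z _ _ _; exact: adj_equiv.
rewrite -(leq_pmul2l (isT : 0 < 2)) mulnC.
have := card_partition (equivalence_partitionP eqR).
rewrite cardsT card_ord => ->; rewrite -sum_nat_const; apply: leq_sum => B.
case/imsetP=> x _ ->; have [y nyx xy] := matching_mate M x.
have c2 : #|[set x; y]| = 2 by rewrite cards2 eq_sym nyx.
rewrite -[leqLHS]c2.
apply/subset_leq_card/subsetP=> z; rewrite !inE => /orP[]/eqP->.
  exact: connect0.
by apply: connect1; rewrite /adj xy.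
Qed.

End Matchings.

(* Main.v *)
(** Superposing [M] and [M'] gives [pi0 M M'] components.  A flip of [M] changes
    this number by at most one, and it equals [n] when [M = M'], whence
    [n - pi0 M M' <= d_mat M M'].  Conversely, if [M <> M'], let [{a, b}] be a
    pair of [M'] outside [M] with [b - a] minimal.  All pairs of [M'] nested
    below [{a, b}] then belong to [M], so no pair of [M] crosses [{a, b}], and
    flipping the pairs of [M] at [a] and [b] so as to create [{a, b}] yields a
    noncrossing matching and splits the component [{a, b}] off.  Iterating
    reaches [M'] in [n - pi0 M M'] noncrossing flips. *)
Require Import Defs.
From mathcomp Require Import all_boot zify.

Set Implicit Arguments.
Unset Strict Implicit.
Unset Printing Implicit Defensive.

(** * Comparing numbers of connected components through their roots *)

Section Components.
Variable T : finType.
Implicit Types (e : rel T) (x y u v : T).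

(** Each class contains exactly one root. Counting roots instead of classes lets two relations be
    compared by maps between their root sets. *)
Lemma card_equivalence_partition_connect e :
  connect_sym e ->
  #|equivalence_partition (connect e) [set: T]| = #|[set x | roots e x]|.
Proof.
move=> sym_e; pose cl x := [set y in [set: T] | connect e x y].
have -> : equivalence_partition (connect e) setT = cl @: [set x | roots e x].
  apply/setP=> B; apply/imsetP/imsetP=> [[x _ ->]|[x _ ->]]; last by exists x.
  exists (root e x); first by rewrite inE roots_root.
  by apply/setP=> y; rewrite !inE (same_connect sym_e (connect_root e x)).
rewrite card_in_imset // => x y; rewrite !inE => /eqP rx /eqP ry /setP/(_ y).
by rewrite !inE connect0 -rx -ry => /esym xy; apply/eqP; rewrite root_connect // -root_connect // -rx -ry root_connect.
Qed.

(** [root e] sends the roots of [e'] injectively to roots of [e]. If [root e x] and [root e y] were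
    both in the image, both would come from the [e']-root shared by [x] and [y], and [x], [y] would
    be [e]-connected. *)
Lemma card_roots_coarser e e' :
  connect_sym e -> connect_sym e' -> subrel e (connect e') ->
  forall x y, connect e' x y -> ~~ connect e x y ->
  #|[set z | roots e' z]| < #|[set z | roots e z]|.
Proof.
move=> sym_e sym_e' /connect_sub sub x y xy' nxy.
have inj : {in [set z | roots e' z] &, injective (root e)}.
  move=> z w; rewrite !inE => /eqP rz /eqP rw /(rootP sym_e)/sub/(rootP sym_e').
  by rewrite rz rw.
rewrite -(card_in_imset inj); apply/proper_card/properP; split.
  by apply/subsetP=> _ /imsetP[z _ ->]; rewrite inE roots_root.
have repr z : root e z \in root e @: [set z | roots e' z] ->
    root e z = root e (root e' z).
  case/imsetP=> r; rewrite inE => /eqP rr zr; rewrite zr -{1}rr.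
  by congr root; apply/(rootP sym_e'); rewrite sym_e'; apply/sub/(rootP sym_e).
have [xr|xr] := boolP (root e x \in root e @: [set z | roots e' z]); last first.
  by exists (root e x); rewrite // inE roots_root.
exists (root e y); first by rewrite inE roots_root.
apply: contra nxy => yr; apply/(rootP sym_e).
by rewrite (repr _ xr) (repr _ yr); congr root; apply/(rootP sym_e').
Qed.

(* The hypothesis puts [e'] inside the equivalence generated by [e] and the
   edge [u -- v]. *)
Lemma card_roots_add_edge e e' u v :
  connect_sym e -> connect_sym e' ->
  (forall x y, e' x y ->
     [\/ connect e x y, connect e x u /\ connect e y v
       | connect e x v /\ connect e y u]) ->
  #|[set z | roots e z]| <= #|[set z | roots e' z]|.+1.
Proof.
move=> sym_e sym_e' step.
(* [g] merges the component of [v] into that of [u]. It is constant along [e'] and still separates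
   all roots of [e] other than [root e v]. *)
pose g x := if root e x == root e v then root e u else root e x.
have g_step x y : e' x y -> g x = g y.
  rewrite /g; case/step=> [/(rootP sym_e)->//||] [/(rootP sym_e)-> /(rootP sym_e)->].
    by rewrite eqxx; case: eqP.
  by rewrite eqxx; case: eqP.
have g_connect x y : connect e' x y -> g x = g y.
  case/connectP=> p + ->; elim: p x => //= z p IH x /andP[/g_step-> /IH].
  exact.
rewrite (cardsD1 (root e v)) inE roots_root // add1n ltnS.
have inj : {in [set z | roots e z] :\ root e v &, injective (root e')}.
  move=> z w; rewrite !inE => /andP[zv /eqP rz] /andP[wv /eqP rw].
  by move/(rootP sym_e')/g_connect; rewrite /g rz rw (negPf zv) (negPf wv).
rewrite -(card_in_imset inj); apply/subset_leq_card/subsetP=> _ /imsetP[z _ ->].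
by rewrite inE roots_root.
Qed.

End Components.

Lemma set2_eqP (T : finType) (x y a b : T) :
  [set x; y] = [set a; b] -> x = a /\ y = b \/ x = b /\ y = a.
Proof.
move=> E; have := set21 x y; have := set22 x y; have := set21 a b.
have := set22 a b; rewrite E -{1 2}E !inE.
by do 4![case/orP=> /eqP ?]; subst; auto.
Qed.

(** * Matchings, and the component count under an arbitrary flip *)

Section Matchings.
Variable n : nat.
Local Notation I := 'I_(2 * n).
Implicit Types (M N : matching n) (S : {set {set I}}) (x y p q a b : I).

Lemma adj_connect_sym M N : connect_sym (adj M N).
Proof. exact/sym_connect_sym/adj_sym. Qed.

Lemma pi0_roots M N : pi0 M N = #|[set z | roots (adj M N) z]|.
Proof. exact/card_equivalence_partition_connect/adj_connect_sym. Qed.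

Lemma is_matchingP S :
  (forall B, B \in S -> #|B| = 2) ->
  (forall x, exists2 B, B \in S & x \in B) ->
  (forall B C x, B \in S -> C \in S -> x \in B -> x \in C -> B = C) ->
  is_matching S.
Proof.
move=> S2 Scov Suniq; apply/andP; split; last by apply/forall_inP=> B /S2->.
apply/and3P; split.
- apply/eqP/setP=> x; rewrite inE; have [B SB xB] := Scov x.
  by apply/bigcupP; exists B.
- apply/trivIsetP=> B C SB SC; apply: contraR => /pred0Pn[x /andP[xB xC]].
  by apply/eqP; apply: (Suniq _ _ x).
- by apply/negP=> /S2; rewrite cards0.
Qed.

Lemma matching_card2 M B : B \in val M -> #|B| = 2.
Proof. by have /andP[_ /forall_inP MC] := valP M; move/MC/eqP. Qed.

Lemma matching_pair_neq M x y : [set x; y] \in val M -> x != y.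
Proof. by move/matching_card2; rewrite cards2; case: eqP. Qed.

Lemma matching_mate_uniq M x y z :
  [set x; y] \in val M -> [set x; z] \in val M -> y = z.
Proof.
move=> xy xz; have := matching_block_eq xy xz (set21 _ _) (set21 _ _).
by case/set2_eqP=> -[] // xz' yx; rewrite -xz' in yx *.
Qed.

Lemma matching_block_pair M B : B \in val M -> exists x y, B = [set x; y].
Proof. by move/matching_card2/eqP/cards2P=> [x [y [_ ->]]]; exists x, y. Qed.

Lemma card_matching M : #|val M| = n.
Proof.
have : 2 * n = #|val M| * 2; last by lia.
have := card_partition (matching_partition M); rewrite cardsT card_ord => E.
by apply: etrans E _; rewrite -sum_nat_const; apply: eq_bigr=> B /matching_card2.
Qed.

Lemma matching_subset_eq M N : val N \subset val M -> M = N.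
Proof.
move=> sNM; apply/val_inj/esym/eqP.
by rewrite eqEcard sNM !card_matching leqnn.
Qed.

(** Every pair of [M] is already a whole class, which gives at least [n] classes; [pi0_le] gives the
    other bound. *)
Lemma pi0_diag M : pi0 M M = n.
Proof.
apply/eqP; rewrite eqn_leq pi0_le -{1}(card_matching M).
apply/subset_leq_card/subsetP=> B MB.
have [x [y eB]] := matching_block_pair MB; rewrite eB in MB *.
apply/imsetP; exists x => //; apply/setP=> z; rewrite [RHS]inE in_setT.
apply/idP/idP=> [/set2P[]->|]; first exact: connect0.
  by apply: connect1; rewrite /adj MB.
case/connectP=> p xp ->; elim: p x y {eB} MB xp => [|w p IH] x y MB /=.
  by rewrite set21.
rewrite /adj orbb => /andP[xw wp].
by rewrite -(matching_mate_uniq xw MB) setUC; apply: IH wp; rewrite setUC.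
Qed.

(** Adding the single edge [i -- j] to the graph of [N] and [P] reconnects both removed pairs: [k]
    and [l] are then joined through [j] and [i]. One added edge merges at most two components. *)
Lemma pi0_flip M N P : flip M N -> pi0 N P <= (pi0 M P).+1.
Proof.
case/existsP=> i /existsP[j /existsP[k /existsP[l]]] /and4P[Mij Mkl _ /eqP eN].
have il : connect (adj N P) i l.
  by apply: connect1; rewrite /adj eN !inE eqxx !orbT.
have jk : connect (adj N P) j k.
  by apply: connect1; rewrite /adj eN !inE eqxx !orbT.
rewrite !pi0_roots.
apply: (card_roots_add_edge (u := i) (v := j)); try exact: adj_connect_sym.
have sym := adj_connect_sym N P.
move=> x y /orP[Mxy|Pxy]; last first.
  by constructor 1; apply: connect1; rewrite /adj Pxy orbT.
have [/set2_eqP[[-> ->]|[-> ->]]|nij] := eqVneq [set x; y] [set i; j].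
- by constructor 2.
- by constructor 3.
have [/set2_eqP[[-> ->]|[-> ->]]|nkl] := eqVneq [set x; y] [set k; l].
- by constructor 3; rewrite !(sym k) !(sym l).
- by constructor 2; rewrite !(sym k) !(sym l).
constructor 1; apply: connect1; rewrite /adj eN !inE.
by rewrite (negPf nij) (negPf nkl) Mxy.
Qed.

(** * The flip that creates a prescribed pair *)

(** The points [a'] and [b'] are meant as the mates of [a] and [b]. Reading [a', a, b, b'] for
    [i, j, k, l] gives the pattern of [flip], with [{a, b}] the pair to be created. *)
Definition flip_set S a a' b b' : {set {set I}} :=
  (S :\: [set [set a'; a]; [set b; b']]) :|: [set [set a'; b']; [set a; b]].

Lemma in_flip_set S a a' b b' B :
  B \in flip_set S a a' b b' =
    (B \notin [set [set a'; a]; [set b; b']]) && (B \in S) ||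
    (B \in [set [set a'; b']; [set a; b]]).
Proof. by rewrite in_setU in_setD. Qed.

Section FlipSet.
Variables (M : matching n) (a a' b b' : I).
Hypotheses (Ma : [set a; a'] \in val M) (Mb : [set b; b'] \in val M).
Hypotheses (ab : a != b) (Mab : [set a; b] \notin val M).

Lemma flip_blocks_neq : [set a'; a] != [set b; b'].
Proof.
apply/eqP=> /set2_eqP[[eb _]|[_ eb]]; last by move: ab; rewrite eb eqxx.
by case/negP: Mab; rewrite -eb.
Qed.

Lemma flip_ends_neq : a' != b'.
Proof.
apply/eqP=> E; case/eqP: flip_blocks_neq; rewrite setUC.
by apply: (matching_block_eq Ma Mb (i := a')); rewrite ?E set22.
Qed.

Lemma flip_set_old B x :
  B \in val M -> B \notin [set [set a'; a]; [set b; b']] -> x \in B ->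
  [/\ x != a, x != a', x != b & x != b'].
Proof.
move=> MB; rewrite !inE negb_or (setUC [set a']) => /andP[nBa nBb] xB; split.
all: apply: contraTneq isT => E; rewrite E in xB.
1,2: by case/eqP: nBa; apply: matching_block_eq MB Ma xB _; rewrite !inE eqxx ?orbT.
all: by case/eqP: nBb; apply: matching_block_eq MB Mb xB _; rewrite !inE eqxx ?orbT.
Qed.

(** The new pairs cover the same four points as the removed ones, and these points are distinct
    because [a != b] and [{a, b}] is not a pair of [M]. *)
Lemma is_matching_flip_set : is_matching (flip_set (val M) a a' b b').
Proof.
have aa' := matching_pair_neq Ma; have bb' := matching_pair_neq Mb.
have a'b' := flip_ends_neq.
have ab' : a != b'.
  by apply: contraNneq Mab => ->; rewrite setUC.
have a'b : a' != b by apply: contraNneq Mab => <-.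
apply: is_matchingP => [B|x|B C x].
- rewrite in_flip_set => /orP[/andP[_ /matching_card2]//|].
  by case/set2P=> ->; rewrite cards2 ?a'b' ?ab.
- have [y _ Mxy] := matching_mate M x.
  have [|old] := boolP ([set x; y] \in [set [set a'; a]; [set b; b']]); last first.
    by exists [set x; y]; rewrite ?set21 // in_flip_set old Mxy.
  have : x \in [set x; y] by rewrite set21.
  move=> + /set2P[] E; rewrite E => /set2P[]->.
  + by exists [set a'; b']; rewrite !inE eqxx ?orbT.
  + by exists [set a; b]; rewrite !inE eqxx ?orbT.
  + by exists [set a; b]; rewrite !inE eqxx ?orbT.
  + by exists [set a'; b']; rewrite !inE eqxx ?orbT.
- rewrite !in_flip_set => /orP[/andP[oB MB]|NB] /orP[/andP[oC MC]|NC] xB xC.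
  + exact: matching_block_eq MB MC xB xC.
  + have [/negPf n1 /negPf n2 /negPf n3 /negPf n4] := flip_set_old MB oB xB.
    by case/set2P: NC xC => ->; rewrite !inE ?n1 ?n2 ?n3 ?n4.
  + have [/negPf n1 /negPf n2 /negPf n3 /negPf n4] := flip_set_old MC oC xC.
    by case/set2P: NB xB => ->; rewrite !inE ?n1 ?n2 ?n3 ?n4.
  + case/set2P: NB xB => ->; case/set2P: NC xC => -> //;
      move=> /set2P[]-> /set2P[] E; move: aa' bb' a'b' ab ab' a'b;
      by rewrite E ?eqxx.
Qed.

Definition flip_matching : matching n :=
  exist (fun S => is_true (is_matching S)) _ is_matching_flip_set.

Lemma flip_flip_matching : flip M flip_matching.
Proof.
apply/existsP; exists a'; apply/existsP; exists a.
apply/existsP; exists b; apply/existsP; exists b'.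
by rewrite (setUC [set a']) Ma Mb -(setUC [set a']) flip_blocks_neq /=.
Qed.

(** The new components refine the old ones, since [a'] and [b'] were already joined through [a] and
    [b]. The refinement is strict: [a] and [a'] get separated. *)
Lemma pi0_flip_matching M' :
  [set a; b] \in val M' -> pi0 M M' < pi0 flip_matching M'.
Proof.
move=> M'ab; rewrite !pi0_roots.
have adj_M x y : [set x; y] \in val M -> connect (adj M M') x y.
  by move=> Mxy; apply: connect1; rewrite /adj Mxy.
have adj_M' x y : [set x; y] \in val M' -> connect (adj M M') x y.
  by move=> Mxy; apply: connect1; rewrite /adj Mxy orbT.
have sym := adj_connect_sym M M'.
have a'b' : connect (adj M M') a' b'.
  apply: (connect_trans (y := a)); first by rewrite sym adj_M.
  by apply: connect_trans (adj_M _ _ Mb); apply: adj_M'.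
apply: (@card_roots_coarser _ _ _ _ _ _ a a'); try exact: adj_connect_sym.
- move=> x y /orP[|/adj_M'//]; rewrite in_flip_set.
  case/orP=> [/andP[_ /adj_M]//|/set2P[]/set2_eqP[] [-> ->] //].
  + by rewrite sym.
  + exact: adj_M'.
  + by rewrite sym adj_M'.
- exact: adj_M.
(* After the flip [{a, b}] is a pair of both matchings, hence a component by itself. *)
have closed_ab : closed (adj flip_matching M') [set a; b].
  apply: intro_closed; first exact: adj_connect_sym.
  have Nab : [set a; b] \in val flip_matching by rewrite !inE eqxx !orbT.
  move=> x y xy xab; have -> : [set a; b] = [set x; y]; last exact: set22.
  case/orP: xy => xy.
    exact: matching_block_eq Nab xy xab (set21 _ _).
  exact: matching_block_eq M'ab xy xab (set21 _ _).
apply/negP=> /(closed_connect closed_ab); rewrite set21 => /esym/set2P[] E.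
  by have := matching_pair_neq Ma; rewrite E eqxx.
by move: Mab; rewrite -E Ma.
Qed.

End FlipSet.

(** * Crossing expressed by separation *)

(* For [p] distinct from [x] and [y], this says that [p] lies strictly between
   [x] and [y], in either order.  The exclusive or makes "[{x, y}] does not
   separate [p] from [q]" transitive in [p, q] and symmetric in the two pairs. *)
Definition between x y p := (x < p) (+) (y < p).

(** Both equalities say that the exclusive or of the four comparisons between [x, y] and [p, q] is
    false. Reversing all four comparisons of distinct points preserves this parity. *)
Lemma between_sym x y p q :
  x != p -> x != q -> y != p -> y != q ->
  between x y p = between x y q -> between p q x = between p q y.
Proof.
rewrite /between -!(inj_eq val_inj) /=; lia.
Qed.

Lemma between_lt a b p : a < b -> p != b -> between a b p = (a < p < b).
Proof. by rewrite /between -(inj_eq val_inj) /=; case: ltngtP; lia. Qed.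

(** An order-free form of noncrossing, which spares later arguments the case analysis on the order
    of the endpoints. *)
Definition uncrossed S := forall x y p q,
  [set x; y] \in S -> [set p; q] \in S ->
  x != p -> x != q -> y != p -> y != q -> between x y p = between x y q.

Lemma noncrossingP M : noncrossing (val M) <-> uncrossed (val M).
Proof.
split=> [nc x y p q Mxy Mpq xp xq yp yq|unc]; last first.
  apply/forallP=> i; apply/forallP=> j; apply/forallP=> k; apply/forallP=> l.
  apply/implyP=> /and3P[ij jk kl]; apply/negP=> /andP[Mik Mjl].
  have : between i k j = between i k l.
    by apply: unc; rewrite // -(inj_eq val_inj) /=; lia.
  by rewrite /between; lia.
have no (i j k l : I) : i < j -> j < k -> k < l ->
    [set i; k] \in val M -> [set j; l] \in val M -> False.
  move=> ij jk kl Mik Mjl.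
  move/forallP/(_ i)/forallP/(_ j)/forallP/(_ k)/forallP/(_ l): nc.
  by rewrite ij jk kl Mik Mjl.
have xy := matching_pair_neq Mxy; have pq := matching_pair_neq Mpq.
wlog ltxy : x y Mxy xy xp xq yp yq / x < y.
  move=> W; case: (ltngtP x y) => [||/val_inj E]; last by rewrite E eqxx in xy.
    exact: W.
  by rewrite /between !(addbC (x < _)); apply: W; rewrite // 1?setUC 1?eq_sym.
wlog ltpq : p q Mpq pq xp xq yp yq / p < q.
  move=> W; case: (ltngtP p q) => [||/val_inj E]; last by rewrite E eqxx in pq.
    exact: W.
  by move=> qp; apply/esym/W; rewrite // 1?setUC 1?eq_sym.
(* Once [x < y] and [p < q], these are the only two interleavings in which the pairs cross. *)
have := no x p y q; have := no p x q y; rewrite Mxy Mpq /between.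
move: xp xq yp yq; rewrite -!(inj_eq val_inj) /=; lia.
Qed.

Lemma pair_order M B :
  B \in val M -> exists x y, x < y /\ B = [set x; y].
Proof.
move=> MB; have [x [y eB]] := matching_block_pair MB.
rewrite eB in MB *; have := matching_pair_neq MB.
case: (ltngtP x y) => [xy _|yx _|/val_inj-> /eqP//]; first by exists x, y.
by exists y, x; rewrite setUC.
Qed.

(** * Choosing the pair to create, and keeping the matching noncrossing *)

Lemma minimal_new_pair M N : noncrossing (val N) -> M <> N ->
  exists a b, [/\ a < b, [set a; b] \in val N, [set a; b] \notin val M &
    forall p q, [set p; q] \in val M -> a < p < b -> a < q < b].
Proof.
move=> /noncrossingP uncN neqMN.
have /subsetPn[B NB MB] : ~~ (val N \subset val M).
  by apply/negP=> /matching_subset_eq.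
have [x [y [xy eB]]] := pair_order NB; rewrite eB in NB MB.
pose new (u : I * I) :=
  [&& u.1 < u.2, [set u.1; u.2] \in val N & [set u.1; u.2] \notin val M].
have new_xy : new (x, y) by rewrite /new xy NB MB.
(* The truncated difference is a true length here, because [new] requires [u.1 < u.2]. *)
case: (arg_minnP (fun u : I * I => u.2 - u.1) new_xy) => -[a b] /=.
case/and3P=> /= ab Nab Mab min_ab; exists a, b; split=> // p q Mpq pab.
have [r rp Npr] := matching_mate N p.
have pa : p != a by apply: contraTneq pab => ->; rewrite ltnn.
have pb : p != b by apply: contraTneq pab => ->; rewrite ltnn andbF.
have ra : r != a.
  apply: contraNneq pb => E; rewrite E setUC in Npr.
  by rewrite (matching_mate_uniq Npr Nab).
have rb : r != b.
  apply: contraNneq pa => E; rewrite E setUC in Npr; rewrite setUC in Nab.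
  by rewrite (matching_mate_uniq Npr Nab).
have rab : a < r < b.
  have : between a b p = between a b r by apply: uncN; rewrite // eq_sym.
  by rewrite !between_lt // pab => <-.
(* The pair [{p, r}] of [N] is shorter than [{a, b}], so by minimality it must belong to [M], which
   forces [q = r]. *)
suff Mpr : [set p; r] \in val M by rewrite (matching_mate_uniq Mpq Mpr).
case: (ltngtP p r) => [pr|pr|/val_inj E]; last by rewrite E eqxx in rp.
- apply: contraT => nMpr; have := min_ab (p, r); rewrite /new /= pr Npr nMpr.
  by move=> /(_ isT); clear -pab rab pr; lia.
- rewrite setUC in Npr *; apply: contraT => nMpr.
  have := min_ab (r, p); rewrite /new /= pr Npr nMpr.
  by move=> /(_ isT); clear -pab rab pr; lia.
Qed.

(** A surviving pair separates neither [a] from [b], nor [a] from [a'], nor [b] from [b']; by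
    transitivity it does not separate [a'] from [b'] either. *)
Lemma uncrossed_flip_set M a a' b b' :
  [set a; a'] \in val M -> [set b; b'] \in val M ->
  a < b -> [set a; b] \notin val M ->
  (forall p q, [set p; q] \in val M -> a < p < b -> a < q < b) ->
  uncrossed (val M) -> uncrossed (flip_set (val M) a a' b b').
Proof.
move=> Ma Mb ltab Mab inside unc.
have old := flip_set_old Ma Mb.
have old_ab x y : [set x; y] \in val M ->
    x != a -> x != b -> y != a -> y != b -> between a b x = between a b y.
  move=> Mxy xa xb ya yb; rewrite !between_lt //.
  by apply/idP/idP; apply: inside; rewrite // setUC.
have old_new x y p q : [set x; y] \in val M ->
    [set x; y] \notin [set [set a'; a]; [set b; b']] ->
    [set p; q] \in [set [set a'; b']; [set a; b]] -> between x y p = between x y q.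
  move=> Mxy oxy.
  have [xa xa' xb xb'] := old _ _ Mxy oxy (set21 _ _).
  have [ya ya' yb yb'] := old _ _ Mxy oxy (set22 _ _).
  have sab : between x y a = between x y b.
    by apply: between_sym (old_ab _ _ Mxy xa xb ya yb); rewrite eq_sym.
  have saa' : between x y a = between x y a' by apply: unc.
  have sbb' : between x y b = between x y b' by apply: unc.
  by case/set2P=> /set2_eqP[] [-> ->]; rewrite -?saa' -?sbb' ?sab.
have aa' := matching_pair_neq Ma; have bb' := matching_pair_neq Mb.
have a'b : a' != b by apply: contraNneq Mab => <-.
have ab' : a != b' by apply: contraNneq Mab => ->; rewrite setUC.
(* Both sides are false: a mate of [a] or [b] strictly inside the interval would, by [inside], put
   [a] or [b] strictly inside too. *)
have s_ends : between a b a' = between a b b'.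
  rewrite !between_lt // 1?eq_sym //.
  have -> : a < a' < b = false.
    by apply/negP=> /(inside a' a); rewrite setUC ltnn => /(_ Ma).
  apply/esym/negP=> /(inside b' b).
  by rewrite setUC ltnn andbF => /(_ Mb).
move=> x y p q Nxy Npq xp xq yp yq; move: Nxy Npq.
rewrite !in_flip_set.
case/orP=> [/andP[oxy Mxy]|nxy] /orP[/andP[opq Mpq]|npq].
- exact: unc.
- exact: old_new.
- by apply: between_sym; rewrite 1?eq_sym //; apply: old_new.
- have s_ends' : between a' b' a = between a' b' b.
    by apply: between_sym s_ends; rewrite // eq_sym.
  move: xp xq yp yq.
  case/set2P: nxy => /set2_eqP[] [-> ->]; case/set2P: npq => /set2_eqP[] [-> ->];
    by rewrite ?eqxx // /between ?(addbC (b < _)) ?(addbC (b' < _)).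
Qed.

End Matchings.

(** * Walks of the required length and the lower bound *)

Lemma exists_splitting_flip n (M N : ncmatching n) : M <> N ->
  exists2 P : ncmatching n, flip M P & pi0 M N < pi0 P N.
Proof.
move=> neqMN; have neqMN' : val M <> val N by move/val_inj.
have [a [b [ab Nab Mab inside]]] := minimal_new_pair (valP N) neqMN'.
have [a' _ Ma] := matching_mate (val M) a.
have [b' _ Mb] := matching_mate (val M) b.
have neq_ab : a != b by rewrite -(inj_eq val_inj) neq_ltn ab.
pose P := flip_matching Ma Mb neq_ab Mab.
have ncP : noncrossing (val P).
  by apply/noncrossingP/uncrossed_flip_set/noncrossingP/(valP M).
exists (exist (fun Q : matching n => is_true (noncrossing (val Q))) P ncP); first exact: flip_flip_matching.
exact: pi0_flip_matching.
Qed.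

Lemma walk_ncm n (M N : ncmatching n) :
  walk (fun P Q : ncmatching n => flip P Q) M N (n - pi0 M N).
Proof.
have [k Ek] : exists k, n - pi0 M N = k by exists (n - pi0 M N).
rewrite Ek; elim: k M Ek => [|k IH] M Ek.
  (* With [n] components already present, a splitting flip would exceed the bound [pi0_le], so
     [M = N]. *)
  case: (eqVneq M N) => [->|/eqP/exists_splitting_flip[P _]].
    by apply/walkP; exists [::].
  by have := pi0_le P N; lia.
case: (eqVneq M N) => [E|/eqP/exists_splitting_flip[P MP lt_MP]].
  by move: Ek; rewrite E pi0_diag; lia.
(* The splitting flip raises the count by at least one and any flip by at most one, so [n - pi0]
   drops by exactly one and the walk has the exact length. *)
have := pi0_flip N MP; have := pi0_le P N => le_P le_MP.
have /walkP[s [sz Ps eN]] := IH P ltac:(lia).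
by apply/walkP; exists (P :: s); rewrite /= MP sz.
Qed.

Lemma walk_ncm_mat n (M N : ncmatching n) k :
  walk (fun P Q : ncmatching n => flip P Q) M N k ->
  walk (@flip n) (M : matching n) (N : matching n) k.
Proof.
case/walkP=> s [sz Ms eN]; apply/walkP.
exists [seq matching_of_ncm P | P <- s].
by rewrite size_map sz last_map -eN path_map.
Qed.

(** Each flip lowers [n - pi0] by at most one, and this quantity vanishes at the endpoint [N] by
    [pi0_diag]. *)
Lemma walk_mat_ge n (M N : matching n) k :
  walk (@flip n) M N k -> n - pi0 M N <= k.
Proof.
case/walkP=> s [<- + eN]; elim: s M eN => [|P s IH] M /= eN.
  by rewrite eN pi0_diag subnn.
case/andP=> MP Ps; have := IH P eN Ps; have := pi0_flip N MP => /=; lia.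
Qed.

Theorem theorem5p7 (n : nat) (hn : 0 < n) (M M' : ncmatching n) :
  d_ncm M M' = d_mat M M' /\
  d_mat M M' = Some (n - pi0 M M').
Proof.
have d_matE : d_mat M M' = Some (n - pi0 M M').
  apply/dist_SomeP; split; first exact/walk_ncm_mat/walk_ncm.
  by move=> m; apply: walk_mat_ge.
split=> //; rewrite d_matE; apply/dist_SomeP; split; first exact: walk_ncm.
(* A noncrossing walk is also a walk among all matchings, so the same lower bound applies. *)
by move=> m /walk_ncm_mat; apply: walk_mat_ge.
Qed.
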